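(* Let $z\in\mathbb{R}\setminus\{0\}$ and let $b_A(t),b_B(t)$ be continuous real functions on an open interval $I$ containing $a$. Consider the system $$\frac{\mathrm{d} x}{\mathrm{d} t}= b_A(t)\left(\frac{\mathrm{e}^{zx}-1}{z}\right),\qquad \frac{\mathrm{d} y}{\mathrm{d} t}=-b_A(t)\,\mathrm{e}^{zx}\,y+b_B(t). \quad (\ast)$$ (i) The change of variables $x=-\frac1z\ln u$, $y=v$ (with $u>0$) transforms $(\ast)$ into the system, independent of $z$, $$\frac{\mathrm{d}u}{\mathrm{d}t}=b_A(t)(u-1),\qquad \frac{\mathrm{d}v}{\mathrm{d}t}=-\frac{b_A(t)}{u}\,v+b_B(t).$$ (ii) The general solution of $(\ast)$ is $$x(t)=-\frac{\ln\left(1-zc_1\,\mathrm{e}^{\gamma(t)}\right)}{z},\qquad \gamma(t)=\int_a^t b_A(s)\,\mathrm{d}s,$$ $$y(t)=\exp\left(-\int_a^t\frac{b_A(s)}{1-zc_1\,\mathrm{e}^{\gamma(s)}}\,\mathrm{d}s\right)\left(c_2+\int_a^t\exp\left(\int_a^s\frac{b_A(\tau)}{1-zc_1\,\mathrm{e}^{\gamma(\tau)}}\,\mathrm{d}\tau\right)b_B(s)\,\mathrm{d}s\right),$$ where $c_1,c_2$ are real constants determined by the initial conditions, on intervals containing $a$ on which $1-zc_1\,\mathrm{e}^{\gamma(t)}>0$.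
   Context: The system $(\ast)$ is the Poisson--Hopf quantum deformation, with deformation parameter $z$, of the Lie--Hamilton system $\dot x=b_A(t)x$, $\dot y=-b_A(t)y+b_B(t)$ based on the two-dimensional book algebra; it is the Hamiltonian system of $h_z=b_A(t)\left(\frac{\mathrm{e}^{zx}-1}{z}\right)y-b_B(t)x$ with respect to $\mathrm{d}x\wedge\mathrm{d}y$. *)

(* Defs.v *)
From Stdlib Require Import Reals.
From Coquelicot Require Import Coquelicot.
Local Open Scope R_scope.

Definition is_interval (J : R -> Prop) : Prop :=
  forall r s t, J r -> J t -> r <= s <= t -> J s.

(* Derivative relative to [J]: the same as [is_derive f t l] when [t] is interior
   to [J], and the one-sided derivative when [t] is an endpoint belonging to [J].
   As in [is_derive], the differential is [fun h => h * l]. *)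
Definition is_derive_on (J : R -> Prop) (f : R -> R) (t l : R) : Prop :=
  filterdiff f (within J (locally t)) (fun h => scal h l).

Definition solves_xy (z : R) (bA bB : R -> R) (J : R -> Prop) (x y : R -> R) : Prop :=
  forall t, J t ->
    is_derive_on J x t (bA t * ((exp (z * x t) - 1) / z)) /\
    is_derive_on J y t (- bA t * exp (z * x t) * y t + bB t).

(* [u] is a divisor: used only for curves with [0 < u]. *)
Definition solves_uv (bA bB : R -> R) (J : R -> Prop) (u v : R -> R) : Prop :=
  forall t, J t ->
    is_derive_on J u t (bA t * (u t - 1)) /\
    is_derive_on J v t (- (bA t / u t) * v t + bB t).

(* (u, v) |-> (x, y), meaningful on the half-plane [0 < u]. *)
Definition change_of_variables (z : R) (p : R * R) : R * R :=
  (- (1 / z) * ln (fst p), snd p).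

Definition gamma (bA : R -> R) (a t : R) : R := RInt bA a t.

Definition den (z : R) (bA : R -> R) (a c1 t : R) : R :=
  1 - z * c1 * exp (gamma bA a t).

Definition sol_x (z : R) (bA : R -> R) (a c1 t : R) : R :=
  - (ln (den z bA a c1 t) / z).

Definition sol_y (z : R) (bA bB : R -> R) (a c1 c2 t : R) : R :=
  exp (- RInt (fun s => bA s / den z bA a c1 s) a t) *
  (c2 + RInt (fun s => exp (RInt (fun tau => bA tau / den z bA a c1 tau) a s) * bB s) a t).

(* Main.v *)
(** The change of variables linearises the first equation: [u = exp (- z x)]
    satisfies [u' = bA (u - 1)], so [(u - 1) exp (- gamma)] is a constant,
    written [- z c1].  This gives [u = den] and in particular [den > 0].  The
    second equation is then linear in [y] with coefficient [- bA / den], and its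
    integrating factor yields the constant [c2].  Evaluating at [t = a] shows
    that [c1] and [c2] are determined by the initial values. *)

Require Import Defs.
From Stdlib Require Import Reals Lra.
From Coquelicot Require Import Coquelicot.
Local Open Scope R_scope.

(** * Calculus of derivatives relative to a set *)

Lemma within_locally_proper (J : R -> Prop) (t : R) :
  J t -> ProperFilter (within J (locally t)).
Proof.
intros Jt; split; [|apply within_filter, locally_filter].
intros P HP; exists t; exact (locally_singleton _ _ HP Jt).
Qed.

Lemma is_filter_lim_within (J : R -> Prop) (t : R) :
  is_filter_lim (within J (locally t)) t.
Proof. now intros P; apply filter_le_within. Qed.

(** [filterdiff] asks for its estimate at every limit of the filter; for [t] in [J] properness
    leaves only [t] itself. *)
Lemma is_filter_lim_within_eq (J : R -> Prop) (t s : R) :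
  J t -> is_filter_lim (within J (locally t)) s -> s = t.
Proof.
intros Jt Hs.
pose proof (within_locally_proper J t Jt).
exact (is_filter_lim_unique s t Hs (is_filter_lim_within J t)).
Qed.

Lemma is_derive_on_is_derive (J : R -> Prop) (f : R -> R) (t l : R) :
  J t -> is_derive f t l -> is_derive_on J f t l.
Proof.
intros Jt Hf.
pose proof (within_locally_proper J t Jt).
exact (filterdiff_locally f t _ (is_filter_lim_within J t) Hf).
Qed.

Lemma is_derive_on_ext (J : R -> Prop) (f g : R -> R) (t l : R) :
  (forall s, J s -> f s = g s) -> J t ->
  is_derive_on J f t l -> is_derive_on J g t l.
Proof.
intros Hfg Jt.
pose proof (within_locally_proper J t Jt) as HF.
apply (@filterdiff_ext_loc _ _ _ _ (@filter_filter _ _ HF)).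
- now apply (filter_forall (F := locally t)).
- intros s Hs; rewrite (is_filter_lim_within_eq J t s Jt Hs); auto.
Qed.

Lemma is_derive_on_continuous (J : R -> Prop) (f : R -> R) (t l : R) :
  is_derive_on J f t l -> filterlim f (within J (locally t)) (locally (f t)).
Proof.
intros Hf.
apply (filterdiff_continuous_aux f); [now exists (fun h => scal h l)|].
apply is_filter_lim_within.
Qed.

(** Continuity of [f] along the relative filter sends that filter into the neighbourhoods of [f t],
    where the two-sided derivative of [g] applies. *)
Lemma is_derive_on_comp (J : R -> Prop) (f g : R -> R) (t l m : R) :
  J t -> is_derive_on J f t l -> is_derive g (f t) m ->
  is_derive_on J (fun s => g (f s)) t (m * l).
Proof.
intros Jt Hf Hg.
pose proof (within_locally_proper J t Jt) as HF.
apply filterdiff_ext_lin with (fun h : R => scal (scal h l) m).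
- apply (filterdiff_comp f g (fun h => scal h l) (fun h => scal h m)).
  + exact Hf.
  + apply (filterdiff_locally g (f t)); [|exact Hg].
    intros P HP; exact (is_derive_on_continuous J f t l Hf P HP).
- intros h; unfold scal; simpl; unfold mult; simpl; ring.
Qed.

Lemma is_derive_on_mult (J : R -> Prop) (f g : R -> R) (t l m : R) :
  J t -> is_derive_on J f t l -> is_derive_on J g t m ->
  is_derive_on J (fun s => f s * g s) t (l * g t + f t * m).
Proof.
intros Jt Hf Hg.
pose proof (within_locally_proper J t Jt) as HF.
apply filterdiff_ext_lin
  with (fun h : R => plus (mult (scal h l) (g t)) (mult (f t) (scal h m))).
- apply (filterdiff_comp_2 f g mult (fun h => scal h l) (fun h => scal h m)
           (fun p q => plus (mult p (g t)) (mult (f t) q)) Hf Hg).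
  apply (@filterdiff_mult R_AbsRing _ _ (f t, g t)); [|exact Rmult_comm].
  (* It remains to see that the pair of [f] and [g] tends to [(f t, g t)] along the relative
     filter. *)
  intros P HP.
  destruct HP as [eps HP].
  pose proof (is_derive_on_continuous J f t l Hf _ (locally_ball (f t) eps)) as Bf.
  pose proof (is_derive_on_continuous J g t m Hg _ (locally_ball (g t) eps)) as Bg.
  unfold filtermap in *.
  generalize (filter_and _ _ Bf Bg); apply filter_imp.
  intros s [Hs1 Hs2]; apply HP; split; assumption.
- intros h; unfold scal, plus, mult; simpl; unfold mult; simpl; ring.
Qed.

Lemma is_derive_on_minus (J : R -> Prop) (f g : R -> R) (t l m : R) :
  J t -> is_derive_on J f t l -> is_derive_on J g t m ->
  is_derive_on J (fun s => f s - g s) t (l - m).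
Proof.
intros Jt Hf Hg.
pose proof (within_locally_proper J t Jt) as HF.
apply filterdiff_ext_lin with (fun h : R => minus (scal h l) (scal h m)).
- exact (filterdiff_minus_fct f g _ _ Hf Hg).
- intros h; unfold minus, plus, opp, scal; simpl; unfold mult; simpl; ring.
Qed.

(** * Constancy of functions with zero relative derivative *)

(** Gives continuity of the extension by constants: a ball around [s] is sent into the ball of the
    same radius around the clamped point. *)
Lemma clamp_lipschitz (r t s s' : R) :
  Rabs (Rmax r (Rmin t s') - Rmax r (Rmin t s)) <= Rabs (s' - s).
Proof.
unfold Rmax, Rmin, Rabs.
repeat (destruct (Rle_dec _ _)); repeat (destruct (Rcase_abs _)); lra.
Qed.

(* [f] need not be continuous at [r] and [t] from outside, so the mean value
   theorem is applied to [f] extended by constants beyond the endpoints. *)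
Lemma is_derive_on_zero_le (J : R -> Prop) (f : R -> R) :
  is_interval J -> (forall t, J t -> is_derive_on J f t 0) ->
  forall r t, J r -> J t -> r <= t -> f t = f r.
Proof.
intros HJ Hf r t Jr Jt Hrt.
set (k := fun s => Rmax r (Rmin t s)).
assert (kJ : forall s, J (k s)).
{ intros s; apply (HJ r _ t Jr Jt); unfold k, Rmax, Rmin.
  repeat (destruct (Rle_dec _ _)); lra. }
assert (k_id : forall s, r <= s <= t -> k s = s).
{ intros s Hs; unfold k, Rmax, Rmin.
  repeat (destruct (Rle_dec _ _)); lra. }
destruct (MVT_gen (fun s => f (k s)) r t (fun _ => 0)) as [c [_ Hc]].
- rewrite (Rmin_left r t Hrt), (Rmax_right r t Hrt); intros s Hs.
  assert (Hloc : locally s (fun s' => r <= s' <= t)).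
  { apply (filter_imp (fun s' => r < s' /\ s' < t)); [intros; lra|].
    apply (open_and _ _ (open_gt r) (open_lt t)); exact Hs. }
  apply is_derive_ext_loc with f.
  + revert Hloc; apply filter_imp; intros s' Hs'; now rewrite k_id.
  + assert (Js : J s) by (apply (HJ r s t Jr Jt); lra).
    destruct (Hf s Js) as [Hlin Hdom]; split; [exact Hlin|].
    intros s1 Hs1 eps.
    pose proof (is_filter_lim_locally_unique _ _ Hs1) as E; subst s1.
    (* All points near the interior point [s] lie in [J], so the relative estimate is an ordinary
       one. *)
    pose proof (Hdom s (is_filter_lim_within J s) eps) as Hw.
    generalize (filter_and _ _ Hloc Hw); apply filter_imp.
    intros s' [Hs' Hi]; apply Hi, (HJ r s' t Jr Jt Hs').
- intros s _; apply continuity_pt_filterlim.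
  (* The clamp [k] takes values in [J], so ordinary neighbourhoods of [s] are enough for the
     relative continuity of [f] at [k s]. *)
  apply (filterlim_comp _ _ _ k f _ (within J (locally (k s)))).
  + intros P [eps HP]; exists eps; intros s' Hs'.
    apply HP; [|apply kJ].
    apply (Rle_lt_trans _ _ _ (clamp_lipschitz r t s s') Hs').
  + exact (is_derive_on_continuous J f (k s) 0 (Hf _ (kJ s))).
- rewrite !k_id in Hc; lra.
Qed.

Lemma is_derive_on_zero (J : R -> Prop) (f : R -> R) :
  is_interval J -> (forall t, J t -> is_derive_on J f t 0) ->
  forall r t, J r -> J t -> f t = f r.
Proof.
intros HJ Hf r t Jr Jt; destruct (Rle_or_lt r t).
- now apply (is_derive_on_zero_le J f HJ Hf).
- symmetry; apply (is_derive_on_zero_le J f HJ Hf); auto; lra.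
Qed.

(** * Primitives of functions continuous near an interval *)

(** The integral is split at [t]: from [a] to [t] the path stays in [J], and from [t] to [s] it
    stays in a ball where [f] is continuous, even if [s] is outside [J]. *)
Lemma locally_ex_RInt (J : R -> Prop) (f : R -> R) (a t : R) :
  is_interval J -> (forall s, J s -> locally s (fun r => continuous f r)) ->
  J a -> J t -> locally t (fun s => ex_RInt f a s).
Proof.
intros HJ Hf Ja Jt.
destruct (Hf t Jt) as [eps Heps]; exists eps; intros s Hs.
apply ex_RInt_Chasles with t; apply (ex_RInt_continuous (V := R_CompleteNormedModule)).
- intros r Hr; apply locally_singleton, Hf.
  revert Hr; unfold Rmin, Rmax; destruct (Rle_dec a t); intros Hr.
  + now apply (HJ a r t).
  + now apply (HJ t r a).
- intros r Hr; apply Heps; revert Hs Hr.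
  unfold ball; simpl; unfold AbsRing_ball, abs, minus, plus, opp; simpl.
  unfold Rmin, Rmax, Rabs; destruct (Rle_dec t s);
    repeat destruct (Rcase_abs _); lra.
Qed.

(* The primitive is differentiated on a neighbourhood of [t], not only at
   points of [J], so that it may occur in another integrand. *)
Lemma locally_is_derive_RInt (J : R -> Prop) (f : R -> R) (a t : R) :
  is_interval J -> (forall s, J s -> locally s (fun r => continuous f r)) ->
  J a -> J t -> locally t (fun s => is_derive (RInt f a) s (f s)).
Proof.
intros HJ Hf Ja Jt.
generalize (filter_and _ _
  (locally_locally _ _ (locally_ex_RInt J f a t HJ Hf Ja Jt)) (Hf t Jt)).
apply filter_imp; intros s [Hs1 Hs2].
apply (is_derive_RInt f (RInt f a) a s); [|exact Hs2].
revert Hs1; apply filter_imp; intros r Hr; exact (RInt_correct (V := R_CompleteNormedModule) f a r Hr).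
Qed.

(** * The change of variables *)

Lemma exists_unique_change_of_variables (z : R) (q : R * R) :
  z <> 0 -> exists! p : R * R, 0 < fst p /\ change_of_variables z p = q.
Proof.
intros hz; destruct q as [x y]; exists (exp (- z * x), y); split.
- split; [apply exp_pos|].
  unfold change_of_variables; simpl; rewrite ln_exp; f_equal; now field.
- intros [u v] [Hu E]; simpl in Hu.
  unfold change_of_variables in E; simpl in E; injection E as <- <-.
  replace (- z * (- (1 / z) * ln u)) with (ln u) by now field.
  now rewrite exp_ln.
Qed.

(** The chain rule is applied to [u = exp (- z x)] in one direction and to [x = - (1 / z) ln u] in
    the other; the identity [exp (z x) = / u] on [J] matches the right-hand sides. *)
Lemma change_of_variables_solves (z : R) (bA bB : R -> R) (J : R -> Prop)
  (x y u v : R -> R) :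
  z <> 0 -> (forall t, J t -> 0 < u t) ->
  (forall t, J t -> (x t, y t) = change_of_variables z (u t, v t)) ->
  (solves_xy z bA bB J x y <-> solves_uv bA bB J u v).
Proof.
intros hz Hu Hxy.
assert (Hx : forall t, J t -> x t = - (1 / z) * ln (u t)).
{ intros t Jt; now injection (Hxy t Jt). }
assert (Hy : forall t, J t -> y t = v t).
{ intros t Jt; now injection (Hxy t Jt). }
assert (Hux : forall t, J t -> exp (- z * x t) = u t).
{ intros t Jt; rewrite (Hx t Jt).
  replace (- z * (- (1 / z) * ln (u t))) with (ln (u t)) by now field.
  now apply exp_ln, Hu. }
assert (Hexp : forall t, J t -> exp (z * x t) = / u t).
{ intros t Jt; rewrite <- (Hux t Jt), <- exp_Ropp; f_equal; ring. }
split; intros H t Jt; destruct (H t Jt) as [H1 H2]; pose proof (Hu t Jt) as Hut;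
  split.
- apply is_derive_on_ext with (fun s => exp (- z * x s)); auto.
  rewrite (Hexp t Jt) in H1.
  replace (bA t * (u t - 1)) with ((- z * u t) * (bA t * ((/ u t - 1) / z)))
    by (field; lra).
  apply (is_derive_on_comp J x (fun w => exp (- z * w))); auto.
  rewrite <- (Hux t Jt); auto_derive; [easy|ring].
- apply is_derive_on_ext with y; auto.
  rewrite (Hexp t Jt), (Hy t Jt) in H2; unfold Rdiv.
  now replace (- (bA t * / u t) * v t) with (- bA t * / u t * v t) by ring.
- apply is_derive_on_ext with (fun s => - (1 / z) * ln (u s)).
  { intros s Js; now rewrite Hx. }
  { exact Jt. }
  rewrite (Hexp t Jt).
  replace (bA t * ((/ u t - 1) / z))
    with ((- (1 / z) / u t) * (bA t * (u t - 1))) by (field; lra).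
  apply (is_derive_on_comp J u (fun w => - (1 / z) * ln w)); auto.
  auto_derive; [exact Hut|field; lra].
- apply is_derive_on_ext with v; auto.
  { intros s Js; now rewrite Hy. }
  rewrite (Hexp t Jt), (Hy t Jt).
  now replace (- bA t * / u t * v t) with (- (bA t / u t) * v t)
    by (unfold Rdiv; ring).
Qed.

(** * Constants and initial values *)

Lemma den_at_initial_time (z : R) (bA : R -> R) (a c1 : R) :
  den z bA a c1 a = 1 - z * c1.
Proof. unfold den, gamma; rewrite RInt_point; unfold zero; simpl; rewrite exp_0; ring. Qed.

Lemma sol_y_at_initial_time (z : R) (bA bB : R -> R) (a c1 c2 : R) :
  sol_y z bA bB a c1 c2 a = c2.
Proof.
unfold sol_y; rewrite !RInt_point; unfold zero; simpl; rewrite Ropp_0, exp_0; ring.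
Qed.

(** At [t = a] all integrals vanish, so [c2] is the value of [y]; positivity of [den] lets the
    exponential undo the logarithm, and [den = 1 - z c1] is solved for [c1]. *)
Lemma initial_conditions_unique (z : R) (bA bB : R -> R) (a x0 y0 : R)
  (c : R * R) :
  z <> 0 -> 0 < den z bA a (fst c) a -> sol_x z bA a (fst c) a = x0 ->
  sol_y z bA bB a (fst c) (snd c) a = y0 ->
  c = ((1 - exp (- z * x0)) / z, y0).
Proof.
intros hz Hd <- <-; destruct c as [c1 c2]; simpl in *.
rewrite sol_y_at_initial_time; f_equal; unfold sol_x.
replace (- z * - (ln (den z bA a c1 a) / z)) with (ln (den z bA a c1 a)) by now field.
rewrite exp_ln, den_at_initial_time by exact Hd; now field.
Qed.

Lemma initial_conditions (z : R) (bA bB : R -> R) (a x0 y0 : R) :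
  z <> 0 ->
  let c1 := (1 - exp (- z * x0)) / z in
  0 < den z bA a c1 a /\ sol_x z bA a c1 a = x0 /\ sol_y z bA bB a c1 y0 a = y0.
Proof.
intros hz c1.
assert (E : den z bA a c1 a = exp (- z * x0)).
{ rewrite den_at_initial_time; unfold c1; now field. }
split; [rewrite E; apply exp_pos|split].
- unfold sol_x; rewrite E, ln_exp; now field.
- apply sol_y_at_initial_time.
Qed.

(** * Explicit solutions and the linear second equation *)

(** [den - 1] is a constant multiple of [exp gamma], so differentiating multiplies it by [bA]. *)
Lemma is_derive_den (z a : R) (bA : R -> R) (c1 t : R) :
  is_derive (gamma bA a) t (bA t) ->
  is_derive (den z bA a c1) t (bA t * (den z bA a c1 t - 1)).
Proof.
intros H; unfold den; auto_derive.
- now exists (bA t).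
- change (fun s => gamma bA a s) with (gamma bA a).
  rewrite (is_derive_unique _ _ _ H); ring.
Qed.

Section Solutions.

Variables (z a : R) (I : R -> Prop) (bA bB : R -> R).
Hypothesis I_open : open I.
Hypothesis I_interval : is_interval I.
Hypothesis I_a : I a.
Hypothesis bA_cont : forall t, I t -> continuous bA t.
Hypothesis bB_cont : forall t, I t -> continuous bB t.

Lemma is_derive_gamma (t : R) : I t -> is_derive (gamma bA a) t (bA t).
Proof.
intros It.
apply (locally_singleton t (fun s => is_derive (RInt bA a) s (bA s))).
apply (locally_is_derive_RInt I); auto.
intros s Is; generalize (I_open s Is); now apply filter_imp.
Qed.

Variables (J : R -> Prop) (c1 : R).
Hypothesis J_interval : is_interval J.
Hypothesis JI : forall t, J t -> I t.
Hypothesis J_a : J a.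
Hypothesis den_pos : forall t, J t -> 0 < den z bA a c1 t.

(** The second equation reads [v' = - p v + bB]; [q] is its inhomogeneous term times the integrating
    factor. *)
Let p (s : R) : R := bA s / den z bA a c1 s.
Let q (s : R) : R := exp (RInt p a s) * bB s.

(** [den] is assumed positive only on [J], but it is continuous on the open set [I], so it stays
    positive near each point of [J], endpoints included. *)
Lemma locally_continuous_p (t : R) : J t -> locally t (fun s => continuous p s).
Proof.
intros Jt.
assert (Hd : forall s, I s -> continuous (den z bA a c1) s).
{ intros s Is; apply (ex_derive_continuous (den z bA a c1)).
  eexists; now apply is_derive_den, is_derive_gamma. }
assert (Hpos : locally t (fun s => 0 < den z bA a c1 s)).
{ apply (Hd t (JI t Jt)), (open_gt 0); now apply den_pos. }
generalize (filter_and _ _ (I_open t (JI t Jt)) Hpos); apply filter_imp.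
intros s [Is Ps]; apply (continuous_mult bA (fun r => / den z bA a c1 r)); auto.
apply (continuous_comp (den z bA a c1) Rinv); auto.
apply continuous_Rinv; lra.
Qed.

Lemma locally_is_derive_RInt_p (t : R) :
  J t -> locally t (fun s => is_derive (RInt p a) s (p s)).
Proof.
intros Jt; apply (locally_is_derive_RInt J); auto; exact locally_continuous_p.
Qed.

Lemma locally_continuous_q (t : R) : J t -> locally t (fun s => continuous q s).
Proof.
intros Jt.
generalize (filter_and _ _ (I_open t (JI t Jt)) (locally_is_derive_RInt_p t Jt)).
apply filter_imp; intros s [Is Ds].
apply (continuous_mult (fun r => exp (RInt p a r)) bB); auto.
apply (continuous_comp (RInt p a) exp).
- apply (ex_derive_continuous (RInt p a)); now exists (p s).
- apply continuous_exp.
Qed.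

Lemma is_derive_RInt_p (t : R) : J t -> is_derive (RInt p a) t (p t).
Proof. intros Jt; exact (locally_singleton _ _ (locally_is_derive_RInt_p t Jt)). Qed.

Lemma is_derive_RInt_q (t : R) : J t -> is_derive (RInt q a) t (q t).
Proof.
intros Jt; apply (locally_singleton t (fun s => is_derive (RInt q a) s (q s))).
apply (locally_is_derive_RInt J); auto; exact locally_continuous_q.
Qed.

Lemma solves_uv_den (c2 : R) :
  solves_uv bA bB J (den z bA a c1) (sol_y z bA bB a c1 c2).
Proof.
intros t Jt; split; apply is_derive_on_is_derive; auto.
- now apply is_derive_den, is_derive_gamma, JI.
(* The primitives are abstracted to [P] and [Q], so that [auto_derive] meets two opaque functions
   instead of nested integrals. *)
- assert (D : forall P Q, is_derive P t (p t) -> is_derive Q t (exp (P t) * bB t) ->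
    is_derive (fun s => exp (- P s) * (c2 + Q s)) t
      (- p t * (exp (- P t) * (c2 + Q t)) + bB t)).
  { intros P Q DP DQ; auto_derive.
    - split; [now exists (p t)|split; [now eexists; exact DQ|easy]].
    - change (fun s => P s) with P; change (fun s => Q s) with Q.
      rewrite (is_derive_unique _ _ _ DP), (is_derive_unique _ _ _ DQ), exp_Ropp.
      field; apply Rgt_not_eq, exp_pos. }
  exact (D _ _ (is_derive_RInt_p t Jt) (is_derive_RInt_q t Jt)).
Qed.

(** Variation of constants: [v] times the integrating factor, minus the primitive of [q], has zero
    derivative and equals [v a] at [a]. *)
Lemma solves_linear_eq_sol_y (v : R -> R) :
  (forall t, J t -> is_derive_on J v t (- p t * v t + bB t)) ->
  forall t, J t -> v t = sol_y z bA bB a c1 (v a) t.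
Proof.
intros Hv t Jt.
set (w := fun s => v s * exp (RInt p a s) - RInt q a s).
assert (E : w t = w a).
{ apply (is_derive_on_zero J w J_interval); auto; intros s Js.
  pose proof (is_derive_RInt_p s Js) as Dp.
  replace 0 with ((- p s * v s + bB s) * exp (RInt p a s)
                  + v s * (exp (RInt p a s) * p s) - q s) by (unfold q; ring).
  apply is_derive_on_minus; [exact Js| |].
  - apply (is_derive_on_mult J v (fun r => exp (RInt p a r))); auto.
    apply (is_derive_on_comp J (RInt p a) exp); auto.
    + now apply is_derive_on_is_derive.
    + apply is_derive_Reals, derivable_pt_lim_exp.
  - apply is_derive_on_is_derive; [exact Js|now apply is_derive_RInt_q]. }
unfold w in E; rewrite !RInt_point in E; unfold zero in E; simpl in E.
rewrite exp_0 in E.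
change (v t = exp (- RInt p a t) * (v a + RInt q a t)).
replace (v a + RInt q a t) with (v t * exp (RInt p a t)) by lra.
rewrite exp_Ropp; field; apply Rgt_not_eq, exp_pos.
Qed.

End Solutions.

(** * Solving the first equation, and the theorem *)

Lemma solves_affine_eq_den (z a : R) (I : R -> Prop) (bA : R -> R) (J : R -> Prop)
  (u : R -> R) :
  z <> 0 -> open I -> is_interval I -> I a ->
  (forall t, I t -> continuous bA t) ->
  is_interval J -> (forall t, J t -> I t) -> J a ->
  (forall t, J t -> is_derive_on J u t (bA t * (u t - 1))) ->
  forall t, J t -> u t = den z bA a ((1 - u a) / z) t.
Proof.
intros hz I_open I_interval I_a bA_cont HJ JI Ja Hu t Jt.
(* The constant value of [w] is [u a - 1], which is [- z c1] for [c1 = (1 - u a) / z]. *)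
set (w := fun s => (u s - 1) * exp (- gamma bA a s)).
assert (E : w t = w a).
{ apply (is_derive_on_zero J w HJ); auto; intros s Js.
  pose proof (is_derive_gamma a I bA I_open I_interval I_a bA_cont s (JI s Js)) as Dg.
  replace 0 with ((bA s * (u s - 1) - 0) * exp (- gamma bA a s)
     + (u s - 1) * (- exp (- gamma bA a s) * bA s)) by ring.
  apply (is_derive_on_mult J (fun r => u r - 1) (fun r => exp (- gamma bA a r)));
    auto.
  - apply (is_derive_on_minus J u (fun _ => 1)); auto.
    apply is_derive_on_is_derive; [exact Js|exact (is_derive_const (K := R_AbsRing) (V := R_NormedModule) 1 s)].
  - apply (is_derive_on_comp J (gamma bA a) (fun g => exp (- g))); auto.
    + now apply is_derive_on_is_derive.
    + auto_derive; [easy|ring]. }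
assert (g0 : gamma bA a a = 0) by exact (RInt_point a bA).
unfold w in E; rewrite g0, Ropp_0, exp_0, Rmult_1_r in E.
unfold den.
replace (z * ((1 - u a) / z)) with (- (u a - 1)) by now field.
rewrite <- E, exp_Ropp; field; apply Rgt_not_eq, exp_pos.
Qed.

Theorem mainTheorem4 (z a : R) (I : R -> Prop) (bA bB : R -> R)
  (hz : z <> 0)
  (I_open : open I) (I_interval : is_interval I) (I_a : I a)
  (bA_cont : forall t, I t -> continuous bA t)
  (bB_cont : forall t, I t -> continuous bB t) :
  (* (i) *)
  ((forall q : R * R, exists! p : R * R, 0 < fst p /\ change_of_variables z p = q) /\
   (forall (J : R -> Prop) (x y u v : R -> R),
      is_interval J -> (forall t, J t -> I t) ->
      (forall t, J t -> 0 < u t) ->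
      (forall t, J t -> (x t, y t) = change_of_variables z (u t, v t)) ->
      (solves_xy z bA bB J x y <-> solves_uv bA bB J u v))) /\
  (* (ii) *)
  ((forall (J : R -> Prop) (c1 c2 : R),
      is_interval J -> (forall t, J t -> I t) -> J a ->
      (forall t, J t -> 0 < den z bA a c1 t) ->
      solves_xy z bA bB J (sol_x z bA a c1) (sol_y z bA bB a c1 c2)) /\
   (forall (J : R -> Prop) (x y : R -> R),
      is_interval J -> (forall t, J t -> I t) -> J a ->
      solves_xy z bA bB J x y ->
      exists! c : R * R,
        forall t, J t ->
          0 < den z bA a (fst c) t /\
          x t = sol_x z bA a (fst c) t /\
          y t = sol_y z bA bB a (fst c) (snd c) t) /\
   (forall x0 y0 : R, exists! c : R * R,
        0 < den z bA a (fst c) a /\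
        sol_x z bA a (fst c) a = x0 /\
        sol_y z bA bB a (fst c) (snd c) a = y0)).
Proof.
split; [split|split; [|split]].
- intros q; now apply exists_unique_change_of_variables.
- intros J x y u v _ _ Hu Hxy; now apply change_of_variables_solves.
- intros J c1 c2 HJ JI Ja Hd.
  (* The solution is checked in the variables [(u, v)], with [u = den], and carried back by part
     (i). *)
  apply (change_of_variables_solves z bA bB J _ _ (den z bA a c1)
           (sol_y z bA bB a c1 c2)); auto.
  + intros t _; unfold change_of_variables, sol_x; simpl; f_equal; now field.
  + now apply (solves_uv_den z a I).
- intros J x y HJ JI Ja Hxy.
  set (u := fun t => exp (- z * x t)).
  assert (Huy : solves_uv bA bB J u y).
  { apply (change_of_variables_solves z bA bB J x y u y); auto.
    - intros t _; apply exp_pos.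
    - intros t _; unfold change_of_variables, u; simpl; rewrite ln_exp; f_equal.
      now field. }
  set (c1 := (1 - u a) / z).
  assert (Eu : forall t, J t -> u t = den z bA a c1 t).
  { apply (solves_affine_eq_den z a I bA J u); auto.
    intros t Jt; apply Huy, Jt. }
  (* Positivity of [den] on all of [J] is inherited from [u], an exponential. *)
  assert (Hd : forall t, J t -> 0 < den z bA a c1 t).
  { intros t Jt; rewrite <- Eu by exact Jt; apply exp_pos. }
  exists (c1, y a); split.
  + intros t Jt; simpl; split; [now apply Hd|split].
    * unfold sol_x; rewrite <- Eu by exact Jt; unfold u; rewrite ln_exp; now field.
    * apply (solves_linear_eq_sol_y z a I bA bB I_open I_interval I_a bA_cont
               bB_cont J c1 HJ JI Ja Hd); auto.
      intros s Js; rewrite <- Eu by exact Js; apply Huy, Js.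
  (* Uniqueness of the constants is read off at the single time [a]. *)
  + intros c Hc; destruct (Hc a Ja) as [H1 [H2 H3]].
    symmetry; now apply (initial_conditions_unique z bA bB a).
- intros x0 y0; exists ((1 - exp (- z * x0)) / z, y0); split.
  + now apply initial_conditions.
  + intros c [H1 [H2 H3]]; symmetry.
    now apply (initial_conditions_unique z bA bB a).
Qed.
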